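(* Let $q\ge 1$ be an integer. For each integer $n\ge 0$, let $a_q(n)$ be the number of arrangements of black and white beads on a necklace with a total of $n$ beads satisfying the following: (i) there is at least one black bead; (ii) between any two (cyclically consecutive) black beads the number of white beads is divisible by $q$; (iii) rotations and flippings of a necklace are considered distinct. Then $a_q(0)=0$, $a_q(1)=\cdots=a_q(q)=1$, and for $n\ge q+1$ $$a_q(n)=\begin{cases} a_q(n-1)+a_q(n-q)+q & \text{if } n\equiv 1 \pmod q,\\ a_q(n-1)+a_q(n-q) & \text{otherwise.}\end{cases}$$
   Context: A necklace on $n$ beads is a coloring, black or white, of the $n$ positions $1,2,\ldots,n$ arranged cyclically (position $1$ at the top, positions increasing clockwise, position $n$ adjacent to position $1$). Since rotations and flippings are considered distinct, necklaces are counted as functions from the set of labelled positions to $\{\text{black},\text{white}\}$. Condition (ii) is read cyclically: for each black bead, the number of white beads strictly between it and the next black bead encountered clockwise must be divisible by $q$. If there is exactly one black bead, the next black bead is that bead itself, so there are $n-1$ white beads between the black bead and itself, and condition (ii) requires $q\mid n-1$. *)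

(* Defs.v *)
From mathcomp Require Import all_boot.

Set Implicit Arguments.
Unset Strict Implicit.
Unset Printing Implicit Defensive.

(* Position k of the necklace (1 <= k <= n) is the ordinal k - 1; clockwise
   succession is [ordS], i.e. i |-> i + 1 mod n.  [true] means black. *)
Definition necklace (n : nat) : finType := {ffun 'I_n -> bool}.

Definition has_black (n : nat) (c : necklace n) : bool := [exists i, c i].

(* The n positions met clockwise from [i] are i + 1, ..., i + n = i, and [find]
   counts those preceding the first black one.  If [i] is black the search
   succeeds, possibly only on coming back to [i] itself; the value is then n - 1
   when [i] is the only black bead. *)
Definition white_gap (n : nat) (c : necklace n) (i : 'I_n) : nat :=
  find c (traject (@ordS n) (ordS i) n).

Definition gaps_divisible (q n : nat) (c : necklace n) : bool :=
  [forall (i | c i), q %| white_gap c i].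

Definition necklace_count (q n : nat) : nat :=
  #|[set c : necklace n | has_black c && gaps_divisible q c]|.

(* Main.v *)
Require Import Defs.
From mathcomp Require Import all_boot.
From mathcomp Require Import zify.

Set Implicit Arguments.
Unset Strict Implicit.
Unset Printing Implicit Defensive.

(** Reading the beads clockwise, keep as state the number [r < q] of white beads
    still required modulo [q] before the next black bead: a black bead is allowed
    only in state 0 and keeps it, a white bead decreases [r] cyclically.  Let [A]
    be the adjacency matrix of this automaton.  A necklace with a black bead
    satisfies the gap condition iff it labels a closed walk, and the initial state
    of that walk is then unique; the all-white necklace labels [q] closed walks
    if [q %| n] and none otherwise.  So [tr (A ^ n) = a_q(n) + q * (q %| n)], and
    the recurrence comes from [A ^ q = A ^ (q - 1) + 1]. *)

(* [walk_count p n r t] is the entry [(r, t)] of [A ^ n] for [q = p.+1]: taking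
   the predecessor of [q] as parameter makes [p] the state that follows 0 on a
   white bead. *)
Fixpoint walk_count (p n r t : nat) : nat :=
  if n is n'.+1 then
    if r is r'.+1 then walk_count p n' r' t
    else walk_count p n' 0 t + walk_count p n' p t
  else r == t.

Definition walk_trace (p n : nat) : nat := \sum_(r < p.+1) walk_count p n r r.

Lemma walk_countD p n k r t :
  walk_count p (n + k) (r + k) t = walk_count p n r t.
Proof. by elim: k => [|k IHk]; rewrite ?addn0 // !addnS. Qed.

Lemma walk_count_descend p n r t :
  n <= r -> walk_count p n r t = (r - n == t).
Proof. by move=> le_nr; rewrite -{1}(subnK le_nr) -{1}[n]add0n walk_countD. Qed.

(** From [r] the walk is forced down to 0 and branches there. A black bead only delays it by one
    step; a white one leads to [p], whence it is forced back to [r] after [p.+1] steps in all. *)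
Lemma walk_count_rec p n r t : r <= p ->
  walk_count p (n + p.+1) r t = walk_count p (n + p) r t + walk_count p n r t.
Proof.
move=> le_rp; pose m := n + (p - r).
have -> : n + p.+1 = m.+1 + r by rewrite /m; lia.
have -> : n + p = m + r by rewrite /m; lia.
rewrite (walk_countD p m.+1 r 0) (walk_countD p m r 0) /=.
by rewrite -(walk_countD p n (p - r) r) subnKC.
Qed.

Lemma walk_trace_rec p n :
  walk_trace p (n + p.+1) = walk_trace p (n + p) + walk_trace p n.
Proof.
rewrite /walk_trace -big_split; apply: eq_bigr => r _.
by rewrite walk_count_rec // -ltnS.
Qed.

(** A walk that leaves 0 restarts from [p] and has too few steps left to come down to [r]. *)
Lemma walk_count_from0 p m r : m + r <= p -> walk_count p m 0 r = (r == 0).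
Proof.
elim: m => [|m IHm] le_mrp; first by rewrite eq_sym.
rewrite /= IHm ?walk_count_descend; [|lia|lia].
have -> : (p - m == r) = false by lia.
by rewrite addn0.
Qed.

Lemma walk_trace_small p n : 0 < n <= p.+1 ->
  walk_trace p n = 1 + p.+1 * (p.+1 %| n).
Proof.
move=> /andP[n_gt0 le_nq].
(* The closed walks this short are [n] black loops at 0 and one full white cycle. *)
have diag (r : 'I_p.+1) : walk_count p n r r = (r == ord0) + (p.+1 == n).
  rewrite -val_eqE /=; have r_lt := ltn_ord r.
  case: (leqP n r) => [le_nr | lt_rn].
    rewrite walk_count_descend //; lia.
  have -> : n = (n - r.+1).+1 + r by lia.
  rewrite (walk_countD p (n - r.+1).+1 r 0) /=.
  rewrite walk_count_from0 ?walk_count_descend; lia.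
rewrite /walk_trace (eq_bigr _ (fun r _ => diag r)) big_split /=.
rewrite sum_nat_const card_ord -big_mkcond /= sum1_card.
rewrite cardE (eq_enum (B := pred1 ord0)) // -cardE card1.
congr (_ + _ * nat_of_bool _); apply/eqP/idP => [-> // | /dvdn_leq -/(_ n_gt0)].
by move: le_nq; lia.
Qed.

(** * Words labelling walks *)

Fixpoint walk (p t r : nat) (w : bitseq) : bool :=
  match w, r with
  | [::], _ => r == t
  | true :: w', 0 => walk p t 0 w'
  | true :: _, _.+1 => false
  | false :: w', 0 => walk p t p w'
  | false :: w', r'.+1 => walk p t r' w'
  end.

Lemma sum_tupleS n (F : seq bool -> nat) :
  \sum_(w : n.+1.-tuple bool) F w =
  \sum_(w : n.-tuple bool) (F (true :: w) + F (false :: w)).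
Proof.
rewrite (reindex (fun bw : bool * n.-tuple bool => [tuple of bw.1 :: bw.2])) /=.
  rewrite -(pair_bigA _ (fun b (w : n.-tuple bool) => F (b :: w))) /=.
  by rewrite big_bool -big_split.
exists (fun w => (thead w, [tuple of behead w])) => [[b w] _ | w _] /=.
  by congr pair; apply: val_inj.
by rewrite [RHS]tuple_eta; apply: val_inj.
Qed.

Lemma sum_walk p n r t :
  \sum_(w : n.-tuple bool) walk p t r w = walk_count p n r t.
Proof.
elim: n r => [|n IHn] r.
  rewrite (eq_bigr (fun=> nat_of_bool (r == t))) => [|w _].
    by rewrite sum_nat_const card_tuple expn0 mul1n.
  by rewrite tuple0.
rewrite (@sum_tupleS n (walk p t r)); case: r => [|r] /=.
  by rewrite big_split /= !IHn.
by under eq_bigr do rewrite add0n; exact: IHn.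
Qed.

(* Number of white beads before the first black one when reading [w], where [e]
   is that number for what follows [w]. *)
Definition black_dist (e : nat) (w : bitseq) : nat :=
  foldr (fun b d => if b then 0 else d.+1) e w.

Lemma black_dist_has e w : has id w -> black_dist e w = find id w.
Proof. by elim: w => //= -[] //= w IHw /IHw ->. Qed.

Lemma black_dist_hasN e w : ~~ has id w -> black_dist e w = size w + e.
Proof. by elim: w => //= -[] //= w IHw /IHw ->. Qed.

Lemma black_dist_find s w :
  has id s -> black_dist (find id s) w = find id (w ++ s).
Proof. by move=> has_s; elim: w => //= -[] //= w ->. Qed.

Lemma black_dist_mod q e w : black_dist (e %% q) w = black_dist e w %[mod q].
Proof.
elim: w => [|[] w IHw] //=; first exact: modn_mod.
by rewrite -addn1 -[in RHS]addn1 -modnDml IHw modnDml.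
Qed.

(** Taking [e := find id w] closes a word with a black bead into a cycle. *)
Fixpoint gaps_ok (q e : nat) (w : bitseq) : bool :=
  if w is b :: w' then (b ==> (q %| black_dist e w')) && gaps_ok q e w'
  else true.

Lemma gaps_okP q e w :
  reflect (forall i, i < size w -> nth false w i ->
             q %| black_dist e (drop i.+1 w))
          (gaps_ok q e w).
Proof.
elim: w => [|b w IHw] /=; first by constructor.
apply: (iffP andP) => [[/implyP ok_b /IHw ok_w] [|i] //= | ok].
  by rewrite drop0 => _ /ok_b.
  by rewrite ltnS; apply: ok_w.
split; last by apply/IHw => i; apply: (ok i.+1).
by apply/implyP => b_true; move: (ok 0 isT b_true) => /=; rewrite drop0.
Qed.

Lemma gaps_ok_mod q e w : gaps_ok q (e %% q) w = gaps_ok q e w.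
Proof. by elim: w => //= b w ->; rewrite /dvdn black_dist_mod. Qed.

Lemma gaps_ok_hasN q e w : ~~ has id w -> gaps_ok q e w.
Proof. by elim: w => //= -[]. Qed.

(** Each colour acts injectively on the states, so the end state [t] and the word determine all
    earlier states: each is the distance to the next black bead modulo [p.+1]. *)
Lemma walkE p t r w : t <= p -> r <= p ->
  walk p t r w = (r == black_dist t w %% p.+1) && gaps_ok p.+1 t w.
Proof.
move=> le_tp; elim: w r => [|b w IHw] r le_rp /=.
  by rewrite modn_small ?andbT.
set d := black_dist t w in IHw *.
have modS : d.+1 %% p.+1 = if d %% p.+1 == p then 0 else (d %% p.+1).+1.
  rewrite -addn1 -modnDml addn1; have := ltn_pmod d (ltn0Sn p).
  rewrite ltnS leq_eqVlt; case: eqP => [-> _ | _ /= lt_dp]; first exact: modnn.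
  by rewrite modn_small.
case: b r le_rp => -[|r] le_rp; rewrite ?mod0n //= IHw ?modS //; try by lia.
- by rewrite eq_sym; case: (d %% p.+1 =P p).
- by congr (_ && _); case: (d %% p.+1 =P p) => // ->; lia.
Qed.

Lemma sum_closed_walk p (w : bitseq) :
  \sum_(r < p.+1) walk p r r w =
  if has id w then gaps_ok p.+1 (find id w) w : nat
  else p.+1 * (p.+1 %| size w).
Proof.
have rE (r : 'I_p.+1) := walkE w (leq_ord r) (leq_ord r).
case: ifPn => [has_w | hasN_w].
  (* A black bead makes the start state independent of the end state, so only [r0] can close the
     walk. *)
  pose r0 : 'I_p.+1 := inord (find id w %% p.+1).
  have r0E : r0 = find id w %% p.+1 :> nat by rewrite inordK ?ltn_pmod.
  rewrite (bigD1 r0) //= big1 => [|r neq_r].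
    by rewrite addn0 rE black_dist_has // r0E eqxx gaps_ok_mod.
  by rewrite rE black_dist_has // -r0E val_eqE (negPf neq_r).
rewrite (eq_bigr (fun=> nat_of_bool (p.+1 %| size w))) => [|r _].
  by rewrite sum_nat_const card_ord.
rewrite rE black_dist_hasN // gaps_ok_hasN // andbT.
rewrite -{1}(modn_small (ltn_ord r)) -{1}[r : nat]add0n eqn_modDr.
by rewrite mod0n eq_sym.
Qed.

(** * Necklaces as words *)

Section NecklaceOfTuple.

Variables (n : nat) (w : n.-tuple bool).

Definition necklace_of_tuple : necklace n := [ffun i => tnth w i].

Lemma has_black_tuple : has_black necklace_of_tuple = has id w.
Proof.
apply/existsP/hasP => [[i] | [_ /tnthP[i ->]] /=]; rewrite ?ffunE => b_i.
  by exists (tnth w i); rewrite ?mem_tnth.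
by exists i; rewrite ffunE.
Qed.

Lemma map_traject_ordS (i : 'I_n) :
  map necklace_of_tuple (traject (@ordS n) (ordS i) n) = rot i.+1 w.
Proof.
have iterE j : iter j (@ordS n) (ordS i) = (i.+1 + j) %% n :> nat.
  elim: j => [|j IHj] /=; first by rewrite addn0.
  by rewrite IHj -addn1 modnDml addn1 addnS.
apply: (@eq_from_nth _ false).
  by rewrite size_map size_traject size_rot size_tuple.
move=> j; rewrite size_map size_traject => lt_jn.
rewrite (nth_map (ordS i)) ?size_traject // nth_traject // ffunE.
rewrite (tnth_nth false) iterE /rot nth_cat size_drop size_tuple.
have lt_in := ltn_ord i; case: ltnP => [lt_j | le_j].
  by rewrite nth_drop modn_small //; lia.
rewrite nth_take; last by lia.
have -> : i.+1 + j = j - (n - i.+1) + n by lia.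
by rewrite modnDr modn_small //; lia.
Qed.

Lemma white_gap_tuple (i : 'I_n) : tnth w i ->
  white_gap necklace_of_tuple i =
  black_dist (find id w) (drop i.+1 w).
Proof.
move=> b_i; transitivity (find id (rot i.+1 w)).
  by rewrite -map_traject_ordS find_map.
(* The wrapped-around part contains the black bead [i] itself, so the search ends there at the
   latest. *)
have has_take : has id (take i.+1 w).
  apply/hasP; exists (tnth w i) => //.
  rewrite (tnth_nth false) -(@nth_take i.+1) //.
  by rewrite mem_nth // size_take size_tuple; case: (ltnP i.+1 n).
rewrite -[in RHS](cat_take_drop i.+1 w) find_cat has_take.
by rewrite cat_take_drop black_dist_find.
Qed.

Lemma gaps_divisible_tuple q :
  gaps_divisible q necklace_of_tuple = gaps_ok q (find id w) w.
Proof.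
apply/forall_inP/gaps_okP => [ok i | ok i].
  rewrite size_tuple => lt_in.
  rewrite -(tnth_nth false w (Ordinal lt_in)) => b_i.
  by rewrite -(white_gap_tuple b_i) ok ?ffunE.
rewrite ffunE => b_i; rewrite white_gap_tuple // ok ?size_tuple //.
by rewrite -tnth_nth.
Qed.

End NecklaceOfTuple.

Lemma necklace_countE q n :
  necklace_count q n =
  \sum_(w : n.-tuple bool) (has id w && gaps_ok q (find id w) w).
Proof.
rewrite /necklace_count -sum1dep_card big_mkcond /=.
rewrite (reindex (@necklace_of_tuple n)) /=.
  apply: eq_bigr => w _.
  by rewrite has_black_tuple gaps_divisible_tuple; case: (_ && _).
exists (fun c : necklace n => [tuple c i | i < n]) => [w _ | c _].
  by apply: eq_from_tnth => i; rewrite tnth_mktuple ffunE.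
by apply/ffunP => i; rewrite ffunE tnth_mktuple.
Qed.

Lemma all_white_tuple n (w : n.-tuple bool) :
  (~~ has id w) = (w == [tuple of nseq n false]).
Proof.
rewrite -all_predC -val_eqE /= (eq_all (a2 := pred1 false)) => [|[]] //.
have -> : nseq n false = nseq (size w) false by rewrite size_tuple.
by apply/all_pred1P/eqP.
Qed.

Lemma walk_trace_necklace p n :
  walk_trace p n = necklace_count p.+1 n + p.+1 * (p.+1 %| n).
Proof.
rewrite /walk_trace; under eq_bigr do rewrite -sum_walk.
rewrite exchange_big necklace_countE /=.
under eq_bigr => w _ do rewrite sum_closed_walk size_tuple.
rewrite (bigID (fun w : n.-tuple bool => has id w)) /=; congr (_ + _).
  rewrite [RHS](bigID (fun w : n.-tuple bool => has id w)) /=.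
  rewrite [X in _ = _ + X]big1 ?addn0 => [|w /negPf -> //].
  by apply: eq_bigr => w ->.
rewrite (eq_bigl _ _ (@all_white_tuple n)) big_pred1_eq.
by rewrite has_nseq andbF.
Qed.

Theorem theorem1 (q : nat) (hq : 1 <= q) :
  [/\ necklace_count q 0 = 0,
      forall n : nat, 1 <= n <= q -> necklace_count q n = 1
    & forall n : nat, q.+1 <= n ->
        necklace_count q n =
          if n == 1 %[mod q]
          then necklace_count q (n - 1) + necklace_count q (n - q) + q
          else necklace_count q (n - 1) + necklace_count q (n - q)].
Proof.
case: q hq => // p _.
have countE n : necklace_count p.+1 n + p.+1 * (p.+1 %| n) = walk_trace p n.
  by rewrite walk_trace_necklace.
split=> [|n n_small|n lt_qn].
- rewrite necklace_countE big1 // => w _.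
  by rewrite tuple0.
- by move: (countE n); rewrite walk_trace_small // => /addIn.
have [m ->] : exists m, n = m + p.+1 by exists (n - p.+1); lia.
have -> : m + p.+1 - 1 = m + p by lia.
rewrite addnK modnDr.
(* The all-white corrections at [n] and [n - q] are equal and cancel; the one at [n - 1] gives the
   extra [q]. *)
have := walk_trace_rec p m; rewrite !walk_trace_necklace.
have -> : (p.+1 %| m + p.+1) = (p.+1 %| m) by rewrite dvdn_addl.
have -> : (m == 1 %[mod p.+1]) = (p.+1 %| m + p).
  by rewrite -(eqn_modDr p) add1n modnn.
by case: (p.+1 %| m + p); rewrite ?muln1 ?muln0; lia.
Qed.
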